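(* Suppose that $m=n$, that every critical point of $\Pi$ is non-singular (i.e. $\nabla\Pi(x)=0$ implies $\det\nabla^2\Pi(x)\neq 0$), that $\bar\varsigma\in\mathcal{S}_a$ is a critical point of $\Pi^d$, and that $\bar x=[\mathbf{G}(\bar\varsigma)]^{-1}f$. (i) If $\bar\varsigma\in\mathcal{S}_a^+$, then $\bar\varsigma$ is a global maximizer of $\Pi^d$ in $\mathcal{S}_a^+$ if and only if $\bar x$ is a global minimizer of $\Pi$ on $\mathbb{R}^n$, i.e., the following canonical min-max statement holds: $$\Pi(\bar x)=\min_{x\in\mathbb{R}^n}\Pi(x)\iff \max_{\varsigma\in\mathcal{S}_a^+}\Pi^d(\varsigma)=\Pi^d(\bar\varsigma).$$ (ii) On the other hand, if $\bar\varsigma\in\mathcal{S}_a^-$, then there exists a neighborhood $\mathcal{X}_o\times\mathcal{S}_o\subset\mathbb{R}^n\times\mathcal{S}_a^-$ of $(\bar x,\bar\varsigma)$ such that either one of the following two statements holds: (A) the double-min duality statement $$\Pi(\bar x)=\min_{x\in\mathcal{X}_o}\Pi(x)\iff \min_{\varsigma\in\mathcal{S}_o}\Pi^d(\varsigma)=\Pi^d(\bar\varsigma),$$ or (B) the double-max duality statement $$\Pi(\bar x)=\max_{x\in\mathcal{X}_o}\Pi(x)\iff \max_{\varsigma\in\mathcal{S}_o}\Pi^d(\varsigma)=\Pi^d(\bar\varsigma).$$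
   Context: Let $m=n$ be a positive integer, let $\mathbf{A}\in\mathbb{R}^{n\times n}$ and $\mathbf{B}^1,\dots,\mathbf{B}^m\in\mathbb{R}^{n\times n}$ be symmetric matrices, $f\in\mathbb{R}^n$, and $d=(d^1,\dots,d^m)\in\mathbb{R}^m$. Define the primal function $\Pi:\mathbb{R}^n\to\mathbb{R}$ by $$\Pi(x)=\frac12\sum_{k=1}^m\Big(\frac12x^T\mathbf{B}^kx-d^k\Big)^2+\frac12x^T\mathbf{A}x-x^Tf .$$ For $\varsigma\in\mathbb{R}^m$ put $\mathbf{G}(\varsigma)=\mathbf{A}+\sum_{k=1}^m\varsigma_k\mathbf{B}^k$, and let $$\mathcal{S}_a=\{\varsigma\in\mathbb{R}^m : f \text{ lies in the column space of } \mathbf{G}(\varsigma)\}.$$ The canonical dual function $\Pi^d:\mathcal{S}_a\to\mathbb{R}$ is $$\Pi^d(\varsigma)=-\frac12f^T[\mathbf{G}(\varsigma)]^{-1}f-\frac12\varsigma^T\varsigma-\varsigma^Td,$$ where $[\mathbf{G}(\varsigma)]^{-1}$ is understood as the generalized inverse if $\det\mathbf{G}(\varsigma)=0$. A critical point of $\Pi^d$ is a point $\varsigma\in\mathcal{S}_a$ with $\nabla\Pi^d(\varsigma)=0$, where the $k$-th component of the gradient is $$\frac12f^T[\mathbf{G}(\varsigma)]^{-1}\mathbf{B}^k[\mathbf{G}(\varsigma)]^{-1}f-\varsigma_k-d^k,\qquad k=1,\dots,m .$$ Further, $\mathcal{S}_a^+=\{\varsigma\in\mathcal{S}_a:\mathbf{G}(\varsigma)\succeq0\}$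 (positive semidefinite) and $\mathcal{S}_a^-=\{\varsigma\in\mathcal{S}_a:\mathbf{G}(\varsigma)\prec0\}$ (negative definite). *)

(* Defs.v *)
From HB Require Import structures.
From mathcomp Require Import all_boot all_order all_algebra.
From mathcomp Require Import all_classical all_reals all_analysis.

Set Implicit Arguments.
Unset Strict Implicit.
Unset Printing Implicit Defensive.

Import Order.TTheory GRing.Theory Num.Theory.
Import numFieldNormedType.Exports.

Local Open Scope classical_set_scope.
Local Open Scope ring_scope.

Section MatrixNotions.
Variable R : realType.

Definition dotv n (u v : 'cV[R]_n) : R := (u^T *m v) 0 0.

Definition bform n (u : 'cV[R]_n) (M : 'M[R]_n) (v : 'cV[R]_n) : R :=
  (u^T *m M *m v) 0 0.

Definition psdmx n (M : 'M[R]_n) : Prop :=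
  M^T = M /\ forall v : 'cV[R]_n, 0 <= bform v M v.

Definition negdefmx n (M : 'M[R]_n) : Prop :=
  M^T = M /\ forall v : 'cV[R]_n, v != 0 -> bform v M v < 0.

(* [mxalgebra]'s [<=%MS] compares row spaces, hence the transpositions. *)
Definition in_colspace n (f : 'cV[R]_n) (M : 'M[R]_n) : Prop :=
  (f^T <= M^T)%MS.

(* The four Penrose equations; [pinvmx] satisfies only the first in general. *)
Definition penrose n (M X : 'M[R]_n) : Prop :=
  [/\ M *m X *m M = M, X *m M *m X = X,
      (M *m X)^T = M *m X & (X *m M)^T = X *m M].

(* Moore-Penrose inverse. The default value 0 of [xget] is never used: see
   [geninvP]; on invertible matrices it is [invmx], see [geninv_unit]. *)
Definition geninv n (M : 'M[R]_n) : 'M[R]_n := xget 0 [set X | penrose M X].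

Lemma in_colspaceP n (f : 'cV[R]_n) (M : 'M[R]_n) :
  in_colspace f M <-> exists x : 'cV[R]_n, M *m x = f.
Proof.
split=> [/submxP[D fE]|[x <-]].
  by exists D^T; apply: trmx_inj; rewrite trmx_mul trmxK.
by rewrite /in_colspace trmx_mul submxMl.
Qed.

Lemma penrose_unique n (M X Y : 'M[R]_n) :
  penrose M X -> penrose M Y -> X = Y.
Proof.
move=> [x1 x2 x3 x4] [y1 y2 y3 y4].
have MXY : M *m X = M *m Y.
  rewrite -x3 -[in LHS]y1 -!mulmxA (mulmxA M Y) trmx_mul x3 y3.
  by rewrite !mulmxA x1.
have XMY : X *m M = Y *m M.
  rewrite -x4 -[in LHS]y1 -!mulmxA mulmxA trmx_mul x4 y4.
  by rewrite -!mulmxA (mulmxA M X) x1.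
by rewrite -x2 -mulmxA MXY mulmxA XMY.
Qed.

Lemma trmulmx_eq0 m n (C : 'M[R]_(m, n)) : C^T *m C = 0 -> C = 0.
Proof.
move=> C0; apply/matrixP => i j; rewrite mxE.
have := congr1 (fun Z : 'M[R]_n => Z j j) C0; rewrite !mxE.
under eq_bigr do rewrite mxE -expr2.
move/psumr_eq0P => s0; have := s0 (fun k _ => sqr_ge0 _) i isT; move/eqP.
by rewrite sqrf_eq0 => /eqP.
Qed.

Lemma row_free_gram m r (P : 'M[R]_(r, m)) :
  row_free P -> P *m P^T \in unitmx.
Proof.
move=> Pf; rewrite -row_free_unit -kermx_eq0; apply/eqP.
set K := kermx _.
have KP0 : (K *m P)^T = 0.
  apply: trmulmx_eq0.
  by rewrite trmxK trmx_mul mulmxA -(mulmxA K) mulmx_ker mul0mx.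
apply/eqP; rewrite -(mulmx_free_eq0 _ Pf); apply/eqP.
by rewrite -[K *m P]trmxK KP0 trmx0.
Qed.

Lemma penrose_exists n (M : 'M[R]_n) : exists X, penrose M X.
Proof.
have [r [C [P [ME uC uP]]]] : exists r (C : 'M[R]_(n, r)) (P : 'M[R]_(r, n)),
    [/\ M = C *m P, C^T *m C \in unitmx & P *m P^T \in unitmx].
  exists (\rank M), (col_base M), (row_base M); split.
  - by rewrite mulmx_base.
  - rewrite -{2}[col_base M]trmxK; apply: row_free_gram.
    by rewrite /row_free mxrank_tr; apply: col_base_full.
  - exact/row_free_gram/row_base_free.
pose X := P^T *m invmx (P *m P^T) *m invmx (C^T *m C) *m C^T.
have MX : M *m X = C *m invmx (C^T *m C) *m C^T.
  by rewrite ME /X !mulmxA -(mulmxA C P) mulmxK.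
have XM : X *m M = P^T *m invmx (P *m P^T) *m P.
  by rewrite ME /X !mulmxA -(mulmxA _ C^T C) mulmxKV.
exists X; split.
- by rewrite MX ME !mulmxA -(mulmxA _ C^T C) mulmxKV.
- by rewrite XM /X !mulmxA -(mulmxA _ P P^T) mulmxKV.
- by rewrite MX !trmx_mul trmxK trmx_inv trmx_mul trmxK mulmxA.
- by rewrite XM !trmx_mul trmxK trmx_inv trmx_mul trmxK mulmxA.
Qed.

Lemma geninvP n (M : 'M[R]_n) : penrose M (geninv M).
Proof. by have [X MX] := penrose_exists M; apply: (xgetPex 0); exists X. Qed.

Lemma geninv_unit n (M : 'M[R]_n) : M \in unitmx -> geninv M = invmx M.
Proof.
move=> uM; apply: (penrose_unique (geninvP M)).
by split; rewrite ?mulmxV ?mulVmx ?mul1mx ?trmx1.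
Qed.

End MatrixNotions.

Section Calculus.
Variable R : realType.

Definition partial n (i : 'I_n) (F : 'cV[R]_n -> R) (x : 'cV[R]_n) : R :=
  'D_(delta_mx i 0 : 'cV[R]_n) F x.

Definition gradient n (F : 'cV[R]_n -> R) (x : 'cV[R]_n) : 'cV[R]_n :=
  \col_i partial i F x.

Definition hessian n (F : 'cV[R]_n -> R) (x : 'cV[R]_n) : 'M[R]_n :=
  \matrix_(i, j) partial i (partial j F) x.

Definition is_min_on (T : Type) (F : T -> R) (X : set T) (x : T) : Prop :=
  X x /\ forall y, X y -> F x <= F y.

Definition is_max_on (T : Type) (F : T -> R) (X : set T) (x : T) : Prop :=
  X x /\ forall y, X y -> F y <= F x.

End Calculus.

Section CanonicalDuality.
Variables (R : realType) (n m : nat).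
Variables (A : 'M[R]_n) (B : 'I_m -> 'M[R]_n) (f : 'cV[R]_n) (d : 'cV[R]_m).

Definition Pi (x : 'cV[R]_n) : R :=
  2^-1 * (\sum_(k < m) (2^-1 * bform x (B k) x - d k 0) ^+ 2)
  + 2^-1 * bform x A x - dotv x f.

Definition G (s : 'cV[R]_m) : 'M[R]_n := A + \sum_(k < m) s k 0 *: B k.

Definition Sa : set 'cV[R]_m := [set s | in_colspace f (G s)].

Definition Sa_plus : set 'cV[R]_m := [set s | Sa s /\ psdmx (G s)].

Definition Sa_minus : set 'cV[R]_m := [set s | Sa s /\ negdefmx (G s)].

Definition Pid (s : 'cV[R]_m) : R :=
  - (2^-1 * bform f (geninv (G s)) f) - 2^-1 * dotv s s - dotv s d.

(* Given by its formula, which still makes sense at points where [G s] is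
   singular; [Pid] need not be differentiable there. *)
Definition grad_Pid (s : 'cV[R]_m) : 'cV[R]_m :=
  \col_k (2^-1 * bform f (geninv (G s) *m B k *m geninv (G s)) f
          - s k 0 - d k 0).

Definition critical_Pid (s : 'cV[R]_m) : Prop := Sa s /\ grad_Pid s = 0.

End CanonicalDuality.

(* Main.v *)
(* At a critical point [s], with [G x = f] for [G = G s], and with [F] the matrix
   of columns [B^k x], two exact expansions hold:
     Pi (x + h) - Pi x = h.Gh / 2 + |F^T h + q(h)|^2 / 2,  [q] quadratic,
     Xi (x + h, s + t) - Xi (x, s) = h.Gh / 2 + h.Ft + h.T(t)h / 2 - |t|^2 / 2,
   where [Xi] is the total complementary function and [T(t) = sum_k t_k B^k].
   If [G] is positive semidefinite, both sides of (i) hold outright.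
   If [P = - G] is positive definite, the Hessian of [Pi] is [F F^T - P] and that
   of the dual is [F^T P^-1 F - 1].  As [F] is square, each is positive
   semidefinite if and only if the other is, and nonsingularity upgrades this to
   definiteness.  So in case (ii) alternative (A) always holds: either both points
   are local minimizers, or neither is. *)
Require Import Defs.
From mathcomp Require Import all_boot all_order all_algebra.
From mathcomp Require Import all_classical all_reals all_analysis.
From mathcomp Require Import ring lra.
Import Order.TTheory GRing.Theory Num.Theory.
Import numFieldNormedType.Exports.
Local Open Scope classical_set_scope.
Local Open Scope ring_scope.

Set Implicit Arguments.
Unset Strict Implicit.

(** * Dot product and quadratic forms *)

Section DotProduct.
Context {R : realType}.
Implicit Types n p : nat.

Lemma dotvE n (u v : 'cV[R]_n) : dotv u v = \sum_i u i 0 * v i 0.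
Proof. by rewrite /dotv mxE; apply: eq_bigr => i _; rewrite mxE. Qed.

Lemma dotvC n (u v : 'cV[R]_n) : dotv u v = dotv v u.
Proof. by rewrite !dotvE; apply: eq_bigr => i _; rewrite mulrC. Qed.

Lemma dotvDr n (u v w : 'cV[R]_n) : dotv u (v + w) = dotv u v + dotv u w.
Proof. by rewrite /dotv mulmxDr mxE. Qed.

Lemma dotvDl n (u v w : 'cV[R]_n) : dotv (u + v) w = dotv u w + dotv v w.
Proof. by rewrite dotvC dotvDr !(dotvC w). Qed.

Lemma dotvZr n a (u v : 'cV[R]_n) : dotv u (a *: v) = a * dotv u v.
Proof. by rewrite /dotv -scalemxAr mxE. Qed.

Lemma dotvZl n a (u v : 'cV[R]_n) : dotv (a *: u) v = a * dotv u v.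
Proof. by rewrite dotvC dotvZr dotvC. Qed.

Lemma dotvNr n (u v : 'cV[R]_n) : dotv u (- v) = - dotv u v.
Proof. by rewrite -scaleN1r dotvZr mulN1r. Qed.

Lemma dotvNl n (u v : 'cV[R]_n) : dotv (- u) v = - dotv u v.
Proof. by rewrite dotvC dotvNr dotvC. Qed.

Lemma dotv0l n (v : 'cV[R]_n) : dotv 0 v = 0.
Proof. by rewrite -(scale0r v) dotvZl mul0r. Qed.

Lemma dotv0r n (v : 'cV[R]_n) : dotv v 0 = 0.
Proof. by rewrite dotvC dotv0l. Qed.

Definition dotvl := (@dotvDl, @dotvDr, @dotvZl, @dotvZr, @dotvNl, @dotvNr).

Lemma dotv_ge0 n (v : 'cV[R]_n) : 0 <= dotv v v.
Proof. by rewrite dotvE sumr_ge0// => i _; rewrite -expr2 sqr_ge0. Qed.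

Lemma sqr_coord_le n (v : 'cV[R]_n) i : v i 0 ^+ 2 <= dotv v v.
Proof.
rewrite dotvE (bigD1 i)//= expr2 lerDl sumr_ge0// => j _.
by rewrite -expr2 sqr_ge0.
Qed.

Lemma dotv_eq0 n (v : 'cV[R]_n) : dotv v v = 0 -> v = 0.
Proof.
move=> v0; apply/matrixP => i j; rewrite ord1 mxE; apply/eqP.
by rewrite -sqrf_eq0 eq_le sqr_ge0 andbT -v0 sqr_coord_le.
Qed.

Lemma dotv_gt0 n (v : 'cV[R]_n) : v != 0 -> 0 < dotv v v.
Proof. by rewrite lt0r dotv_ge0 andbT => /eqP v0; apply/eqP => /dotv_eq0. Qed.

Lemma dotv_trmx n p (M : 'M[R]_(n, p)) u v :
  dotv (M^T *m u) v = dotv u (M *m v).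
Proof. by rewrite /dotv trmx_mul trmxK mulmxA. Qed.

Lemma dotv_sym n (M : 'M[R]_n) u v :
  M^T = M -> dotv u (M *m v) = dotv v (M *m u).
Proof. by move=> MT; rewrite -dotv_trmx MT dotvC. Qed.

Lemma bformE n (u v : 'cV[R]_n) (M : 'M[R]_n) : bform u M v = dotv u (M *m v).
Proof. by rewrite /bform -mulmxA. Qed.

Lemma quad_bound n (M : 'M[R]_n) :
  exists2 C, 0 < C & forall v, `|dotv v (M *m v)| <= C * dotv v v.
Proof.
exists (1 + \sum_i \sum_j `|M i j|) => [|v].
  by rewrite ltr_wpDr// sumr_ge0// => i _; rewrite sumr_ge0.
rewrite dotvE mulrDl mul1r -[leLHS]add0r lerD ?dotv_ge0// mulr_suml.
apply: le_trans (ler_norm_sum _ _ _) _; apply: ler_sum => i _.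
rewrite mxE mulr_sumr mulr_suml.
apply: le_trans (ler_norm_sum _ _ _) _; apply: ler_sum => j _.
rewrite mulrCA normrM ler_wpM2l//.
have := sqr_coord_le v i; have := sqr_coord_le v j.
rewrite ler_norml; move: (v i 0) (v j 0) (dotv v v) => a b c ha hb.
by apply/andP; split; nra.
Qed.

End DotProduct.

(** * Positive definite matrices *)

Section Definite.
Context {R : realType}.
Variable n : nat.
Implicit Types (M P : 'M[R]_n) (u v w : 'cV[R]_n).

Definition posdef M : Prop :=
  M^T = M /\ forall v, v != 0 -> 0 < dotv v (M *m v).

Lemma posdef_ge0 M v : posdef M -> 0 <= dotv v (M *m v).
Proof.
move=> [_ Mp]; have [->|/Mp/ltW//] := eqVneq v 0.
by rewrite mulmx0 dotv0r.
Qed.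

Lemma posdef_unit M : posdef M -> M \in unitmx.
Proof.
move=> [MT Mp]; rewrite -row_free_unit -kermx_eq0; apply/eqP/row_matrixP => i.
rewrite row0; apply/eqP/negPn/negP => k0.
set k := row i (kermx M) in k0.
have kM : M *m k^T = 0 by rewrite -[M]MT -trmx_mul -row_mul mulmx_ker row0 trmx0.
have /Mp : k^T != 0 by rewrite -trmx0 (inj_eq trmx_inj).
by rewrite kM dotv0r ltxx.
Qed.

Lemma cauchy_schwarz_psd M u v : psdmx M ->
  dotv u (M *m v) ^+ 2 <= dotv u (M *m u) * dotv v (M *m v).
Proof.
move=> [MT Mp].
have H a b : 0 <= a ^+ 2 * dotv u (M *m u) + 2 * a * b * dotv u (M *m v)
    + b ^+ 2 * dotv v (M *m v).
  have := Mp (a *: u + b *: v).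
  rewrite bformE mulmxDr -!scalemxAr !dotvl (dotv_sym v u)//.
  by congr (_ <= _); ring.
move: (Mp u) (Mp v) H; rewrite !bformE.
move: (dotv u (M *m u)) (dotv u (M *m v)) (dotv v (M *m v)) => a b c a0 c0 H.
have [c_gt0|] := ltrP 0 c.
  (* At (c, - b) the form equals c (a c - b^2). *)
  have := H c (- b); nra.
move=> cle; have c00 : c = 0 by lra.
(* With c = 0 this choice leaves - (a + 2) b^2 >= 0, which forces b = 0. *)
subst c; have := H b (- (a + 1)); nra.
Qed.

Lemma posdef_psd M : posdef M -> psdmx M.
Proof.
by move=> Mp; split=> [|v]; [case: Mp | rewrite bformE posdef_ge0].
Qed.

(** If v . M v = 0, Cauchy-Schwarz against M v gives M v = 0. This is how nonsingularity of the
    Hessian becomes definiteness. *)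
Lemma psd_unit_posdef M : psdmx M -> M \in unitmx -> posdef M.
Proof.
move=> Mp uM; have MT := Mp.1; split=> // v v0; rewrite lt0r.
have := Mp.2 v; rewrite bformE => ->; rewrite andbT.
apply: contra v0 => /eqP vMv; rewrite -(mulKmx uM v).
suff -> : M *m v = 0 by rewrite mulmx0.
apply: dotv_eq0; apply/eqP; rewrite -sqrf_eq0 eq_le sqr_ge0 andbT.
by apply: le_trans (cauchy_schwarz_psd _ _ Mp) _; rewrite vMv mulr0.
Qed.

(* By Cauchy-Schwarz, [|v|^4 = (v . M M^-1 v)^2 <= (v . M v) (v . M^-1 v)],
   and the last factor is at most a multiple of [|v|^2]. *)
Lemma posdef_coercive M : posdef M ->
  exists2 c, 0 < c & forall v, dotv v v <= c * dotv v (M *m v).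
Proof.
move=> Mp; have uM := posdef_unit Mp; have MT := Mp.1.
have [c c0 cP] := quad_bound (invmx M); exists c => // v.
have := cauchy_schwarz_psd v (invmx M *m v) (posdef_psd Mp).
rewrite mulKVmx// (dotvC (invmx M *m v)).
have [->|v0] := eqVneq v 0; first by rewrite mulmx0 !dotv0r mulr0.
have := cP v; rewrite ler_norml => /andP[_].
have := dotv_gt0 v0; have := posdef_ge0 v Mp.
move: (dotv v v) (dotv v (M *m v)) (dotv v (invmx M *m v)) => a b d b0 a0 da h.
by have bda := ler_wpM2l b0 da; rewrite -(ler_pM2l a0); lra.
Qed.

(* [1 <= F^T P^-1 F] implies [P <= F F^T]: this is where [F] must be square. *)
Lemma psd_swap (F P : 'M[R]_n) : F \in unitmx -> P \in unitmx ->
  (forall w, dotv w w <= dotv (F *m w) (invmx P *m (F *m w))) ->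
  forall y, dotv y (P *m y) <= dotv (F^T *m y) (F^T *m y).
Proof.
move=> uF uP H y; set w := invmx F *m (P *m y).
have Fw : F *m w = P *m y by rewrite mulKVmx.
have := H w; rewrite Fw mulKmx// (dotvC _ y).
(* Expand the square, using F^T y . w = y . P y and |w|^2 <= y . P y. *)
have := dotv_ge0 (F^T *m y - w).
have : dotv (F^T *m y) w = dotv y (P *m y) by rewrite dotv_trmx Fw.
by rewrite !dotvl (dotvC w (F^T *m y)); lra.
Qed.

(** Strict converse of [psd_swap]: with y = F^-T w and u = P^-1 F w, expand (u - y) . P (u - y) >=
    0, where y . P u = |w|^2. *)
Lemma posdef_swap (F P : 'M[R]_n) : F \in unitmx -> posdef P ->
  (forall y, y != 0 -> dotv y (P *m y) < dotv (F^T *m y) (F^T *m y)) ->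
  forall w, w != 0 -> dotv w w < dotv (F *m w) (invmx P *m (F *m w)).
Proof.
move=> uF Pp H w w0; have uP := posdef_unit Pp.
have uFT : F^T \in unitmx by rewrite unitmx_tr.
set y := invmx F^T *m w; set u := invmx P *m (F *m w).
have Fy : F^T *m y = w by rewrite mulKVmx.
have y0 : y != 0 by apply: contra w0 => /eqP y0; rewrite -Fy y0 mulmx0.
have Pu : P *m u = F *m w by rewrite mulKVmx.
have := H y y0; have := posdef_ge0 (u - y) Pp.
rewrite mulmxBr Pu !dotvl Fy -(dotv_trmx F y) Fy.
rewrite -(dotv_sym y)//; last by case: Pp.
by rewrite Pu -(dotv_trmx F y) Fy (dotvC u); lra.
Qed.

End Definite.

Lemma dotv_delta {R : realType} n (i : 'I_n) (u : 'cV[R]_n) :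
  dotv (delta_mx i 0) u = u i 0.
Proof.
rewrite dotvE (bigD1 i)//= big1 ?addr0 => [|k ki]; rewrite mxE.
  by rewrite !eqxx mul1r.
by rewrite (negPf ki) mul0r.
Qed.

(** * Neighborhoods and directional derivatives *)

Section Neighborhoods.
Context {R : realType}.

Lemma nbhs_dotv_lt n (a : 'cV[R]_n) (e : R) : 0 < e ->
  nbhs a [set x | dotv (x - a) (x - a) < e].
Proof.
(* Matrix balls bound each coordinate by r; as r < 1, the n squares are each at most r, and r n <
   e. *)
move=> e0; set r := e / (e + n%:R + 1).
have n0 : 0 <= n%:R :> R by [].
have D0 : 0 < e + n%:R + 1 by lra.
have r0 : 0 < r by rewrite divr_gt0.
have r1 : r < 1 by rewrite ltr_pdivrMr//; lra.
have re : r * n%:R < e.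
  by rewrite mulrAC ltr_pdivrMr// ltr_pM2l//; lra.
apply/nbhs_ballP; exists r => //= x [_ xr].
rewrite /= dotvE; apply: le_lt_trans re.
rewrite mulr_natr -[in leRHS](card_ord n) -sumr_const; apply: ler_sum => i _.
have := xr i 0; rewrite /ball/= distrC ltr_norml !mxE.
by move=> /andP[]; nra.
Qed.

(** Off 0 the difference quotient is the polynomial L + h p(h), which is continuous; exact
    expansions thus yield derivatives. *)
Lemma derive_expansion n (F : 'cV[R]_n -> R) (a v : 'cV[R]_n) (L : R)
    (p : {poly R}) :
  (forall h, F (h *: v + a) = F a + h * L + h ^+ 2 * p.[h]) -> 'D_v F a = L.
Proof.
move=> FE; apply: cvg_lim => //.
have : horner (L%:P + 'X * p) x @[x --> (0 : R)^'] --> L.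
  have {2}-> : L = (L%:P + 'X * p).[0] by rewrite !hornerE.
  by apply: cvg_within_filter; exact: continuous_horner.
apply: cvg_trans; apply: near_eq_cvg; near=> h.
have h0 : h != 0 by near: h; exact: nbhs_dnbhs_neq.
rewrite /= FE !hornerE; rewrite /GRing.scale/=; field.
exact: h0.
Unshelve. all: by end_near. Qed.

End Neighborhoods.

(** The transpose satisfies the Penrose equations of the same M, so uniqueness applies. *)
Lemma geninv_sym {R : realType} n (M : 'M[R]_n) :
  M^T = M -> (geninv M)^T = geninv M.
Proof.
move=> MT; have [p1 p2 p3 p4] := geninvP M.
apply: (@penrose_unique _ _ M); last exact: geninvP.
have MX : M *m (geninv M)^T = geninv M *m M by rewrite -p4 trmx_mul MT.
have XM : (geninv M)^T *m M = M *m geninv M by rewrite -p3 trmx_mul MT.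
split.
- by rewrite -[RHS]MT -[in RHS]p1 !trmx_mul MT mulmxA.
- by rewrite -[in RHS]p2 !trmx_mul MT mulmxA.
- by rewrite MX p4.
- by rewrite XM p3.
Qed.

Lemma small_sqr {R : realType} (N r : R) : 0 <= N -> 0 < r ->
  exists2 a, 0 < a & a ^+ 2 * N < r.
Proof.
move=> N0 r0; have D0 : 0 < r + N + 1 by lra.
set a := r / (r + N + 1); have a0 : 0 < a by rewrite divr_gt0.
have a1 : a <= 1 by rewrite ler_pdivrMr//; lra.
have aN : a * N < r by rewrite mulrAC ltr_pdivrMr// ltr_pM2l//; lra.
exists a => //; apply: le_lt_trans aN; rewrite ler_wpM2r// expr2; nra.
Qed.

(** * Expansions of the primal and total complementary functions *)

Section CanonicalDuality.
Context {R : realType} {n m : nat}.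
Variables (A : 'M[R]_n) (B : 'I_m -> 'M[R]_n) (f : 'cV[R]_n) (d : 'cV[R]_m).
Hypotheses (hA : A^T = A) (hB : forall k, (B k)^T = B k).
Implicit Types (x y h v : 'cV[R]_n) (s t : 'cV[R]_m).

Definition Bcomb t : 'M[R]_n := \sum_k t k 0 *: B k.

(** The matrix F of the overview; its transpose is the Jacobian of [halfquad] at x. *)
Definition Bcols x : 'M[R]_(n, m) := \matrix_(i, k) (B k *m x) i 0.

Definition halfquad x : 'cV[R]_m := \col_k (2^-1 * dotv x (B k *m x)).

Lemma BcombD s t : Bcomb (s + t) = Bcomb s + Bcomb t.
Proof.
by rewrite -big_split; apply: eq_bigr => k _ /=; rewrite mxE scalerDl.
Qed.

Lemma BcombZ a t : Bcomb (a *: t) = a *: Bcomb t.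
Proof. by rewrite scaler_sumr; apply: eq_bigr => k _; rewrite mxE scalerA. Qed.

Lemma Bcomb_sym t : (Bcomb t)^T = Bcomb t.
Proof.
by rewrite /Bcomb raddf_sum; apply: eq_bigr => k _ /=; rewrite linearZ/= hB.
Qed.

Lemma Bcomb_mul t x : Bcomb t *m x = Bcols x *m t.
Proof.
apply/matrixP => i j; rewrite ord1 mulmx_suml summxE mxE.
by apply: eq_bigr => k _; rewrite -scalemxAl mxE [in RHS]mxE mulrC.
Qed.

Lemma dotv_halfquad x t : dotv (halfquad x) t = 2^-1 * dotv x (Bcomb t *m x).
Proof.
rewrite Bcomb_mul -dotv_trmx !dotvE mulr_sumr; apply: eq_bigr => k _.
rewrite !mxE mulrA dotvE; congr (_ * _ * _).
by apply: eq_bigr => i _; rewrite !mxE mulrC.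
Qed.

Lemma halfquadD x h :
  halfquad (x + h) = halfquad x + (Bcols x)^T *m h + halfquad h.
Proof.
apply/matrixP => k j; rewrite ord1 !mxE.
have -> : \sum_i (Bcols x)^T k i * h i 0 = dotv h (B k *m x).
  by rewrite dotvE; apply: eq_bigr => i _; rewrite !mxE mulrC.
by rewrite mulmxDr !dotvl (dotv_sym x h)//; field.
Qed.

Lemma halfquadBD x h : halfquad (x + h) - d =
  halfquad x - d + ((Bcols x)^T *m h + halfquad h).
Proof. by rewrite halfquadD addrAC (addrAC _ _ (- d)) addrA. Qed.

Lemma halfquadZ a h : halfquad (a *: h) = a ^+ 2 *: halfquad h.
Proof.
by apply/matrixP => k j; rewrite !mxE -scalemxAr !dotvl; ring.
Qed.

Lemma GE s : G A B s = A + Bcomb s. Proof. by []. Qed.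

Lemma GD s t : G A B (s + t) = G A B s + Bcomb t.
Proof. by rewrite !GE BcombD addrA. Qed.

Lemma G_sym s : (G A B s)^T = G A B s.
Proof. by rewrite GE linearD/= hA Bcomb_sym. Qed.

Lemma PiE x : Pi A B f d x =
  2^-1 * dotv (halfquad x - d) (halfquad x - d) + 2^-1 * dotv x (A *m x)
  - dotv x f.
Proof.
rewrite /Pi bformE [dotv (_ - d) _]dotvE; congr (_ * _ + _ - _); apply: eq_bigr => k _.
by rewrite !mxE bformE expr2.
Qed.

(** Valid at every x: pairing [halfquad x - d] with the linear and quadratic increments of
    [halfquad] produces the [Bcomb] part of [G]. *)
Lemma PiD x h : Pi A B f d (x + h) = Pi A B f d x
  + dotv h (G A B (halfquad x - d) *m x - f)
  + 2^-1 * dotv h (G A B (halfquad x - d) *m h)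
  + 2^-1 * dotv ((Bcols x)^T *m h + halfquad h)
                ((Bcols x)^T *m h + halfquad h).
Proof.
rewrite !PiE halfquadBD.
set s := halfquad x - d; set a := _ *m h; set q := halfquad h.
have sa : dotv a s = dotv h (Bcomb s *m x) by rewrite dotv_trmx Bcomb_mul.
have sq : dotv q s = 2^-1 * dotv h (Bcomb s *m h) by rewrite dotv_halfquad.
clearbody s a q; rewrite GE !mulmxDl !mulmxDr !dotvl (dotv_sym x h)//.
by rewrite sa sq (dotvC s a) (dotvC s q) sa sq; field.
Qed.

Lemma gradient_Pi x :
  gradient (Pi A B f d) x = G A B (halfquad x - d) *m x - f.
Proof.
apply/matrixP => i j; rewrite ord1 [LHS]mxE -dotv_delta /partial.
set v := delta_mx i 0.
set a := (Bcols x)^T *m v; set q := halfquad v.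
(* The coefficients of h^2, h^3 and h^4 in [PiD] along [h *: v]. *)
apply: (@derive_expansion _ _ _ _ _ _
  ((2^-1 * dotv v (G A B (halfquad x - d) *m v) + 2^-1 * dotv a a)%:P
   + dotv a q *: 'X + (2^-1 * dotv q q) *: 'X^2)) => h.
rewrite addrC PiD halfquadZ -!scalemxAr !dotvl !(hornerD, hornerC, hornerZ, hornerX, hornerXn) -/a -/q (dotvC q a).
by field.
Qed.

Lemma hessian_Pi x : hessian (Pi A B f d) x =
  G A B (halfquad x - d) + Bcols x *m (Bcols x)^T.
Proof.
set M := RHS.
have MT : M^T = M by rewrite /M linearD/= trmx_mul trmxK G_sym.
(* Differentiating the j-th gradient entry along the i-th axis gives entry (j, i) of M, hence the
   transposition. *)
apply/matrixP => i j; rewrite -[in RHS]MT [LHS]mxE [RHS]mxE {1}/partial.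
set v := delta_mx i 0.
have -> : partial j (Pi A B f d) =
    fun y => (G A B (halfquad y - d) *m y - f) j 0.
  by apply/funext => y; rewrite -gradient_Pi [RHS]mxE.
have <- (N : 'M[R]_n) : (N *m v) j 0 = N j i by rewrite -colE mxE.
set a := (Bcols x)^T *m v; set q := halfquad v.
apply: (@derive_expansion _ _ _ _ _ _
  (((Bcomb q *m x) j 0 + (Bcomb a *m v) j 0)%:P
   + (Bcomb q *m v) j 0 *: 'X)) => h.
rewrite (addrC _ x) halfquadBD halfquadZ GD BcombD -!scalemxAr -/a -/q !BcombZ.
rewrite mulmxDr !mulmxDl -!scalemxAr.
rewrite -!scalemxAl -mulmxA -/a -Bcomb_mul.
rewrite !(hornerD, hornerC, hornerZ, hornerX, hornerXn) !mxE.
ring.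
Qed.

(* Gao and Strang's total complementary function: if [G s] is semidefinite,
   [Pid s] is the extremal value of [Xi _ s], attained where [G s *m x = f]. *)
Definition Xi x s : R :=
  2^-1 * dotv x (G A B s *m x) - dotv x f - 2^-1 * dotv s s - dotv s d.

Lemma XiDl y h s : G A B s *m y = f ->
  Xi (y + h) s = Xi y s + 2^-1 * dotv h (G A B s *m h).
Proof.
move=> Gy; rewrite /Xi mulmxDr !dotvl (dotv_sym y h) ?G_sym// Gy.
by field.
Qed.

(** [halfquad x = s + d] is stationarity of [Xi x] in the dual variable: it cancels the terms linear
    in t alone. *)
Lemma XiD x h s t : G A B s *m x = f -> halfquad x = s + d ->
  Xi (x + h) (s + t) = Xi x s + 2^-1 * dotv h (G A B s *m h)
    + dotv h (Bcols x *m t) + 2^-1 * dotv h (Bcomb t *m h) - 2^-1 * dotv t t.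
Proof.
move=> Gx Lx; have := dotv_halfquad x t; rewrite Lx !dotvl => st.
rewrite /Xi GD mulmxDr !(mulmxDl (G A B s)) !dotvl (dotv_sym x h) ?G_sym// Gx.
rewrite (dotv_sym x h) ?Bcomb_sym// -Bcomb_mul (dotvC t s) (dotvC t d).
lra.
Qed.

(** The first Penrose equation makes [geninv] return a solution y whenever one exists; then y . G y
    = y . f collapses [Xi] to [Pid]. *)
Lemma Pid_Xi s : Sa A B f s ->
  G A B s *m (geninv (G A B s) *m f) = f /\
  Pid A B f d s = Xi (geninv (G A B s) *m f) s.
Proof.
move=> /in_colspaceP[z zf]; have [p1 _ _ _] := geninvP (G A B s).
set y := geninv _ *m f.
have Gy : G A B s *m y = f by rewrite /y -[in LHS]zf !mulmxA p1.
by split=> //; rewrite /Pid /Xi bformE -/y Gy (dotvC f); field.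
Qed.

(** Symmetry of the generalized inverse X turns f . X B^k X f into y . B^k y with y = X f. *)
Lemma grad_Pid_eq0 s : grad_Pid A B f d s = 0 ->
  halfquad (geninv (G A B s) *m f) = s + d.
Proof.
move=> g0; apply/matrixP => k j; rewrite ord1.
have := congr1 (fun M : 'cV[R]_m => M k 0) g0; rewrite !mxE bformE.
rewrite -!mulmxA -(dotv_trmx (geninv (G A B s))) geninv_sym ?G_sym//; lra.
Qed.

(** * Small perturbations of definite forms *)

(** The bound |t_k| <= r gives |h . T(t) h| <= r K |h|^2 <= r K c (h . P h), with r K c <= e. Being
    relative to P and uniform in h, the estimate can be absorbed into P later. *)
Lemma Bcomb_small (P : 'M[R]_n) (e : R) : posdef P -> 0 < e ->
  exists2 r, 0 < r & forall t, dotv t t < r ->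
    forall h, `|dotv h (Bcomb t *m h)| <= e * dotv h (P *m h).
Proof.
move=> Pp e0; have [c c0 cP] := posdef_coercive Pp.
have /boolp.choice[C CP] k : exists K, 0 < K /\
    forall v, `|dotv v (B k *m v)| <= K * dotv v v.
  by have [K K0 KP] := quad_bound (B k); exists K.
set K := \sum_k C k.
have K0 : 0 <= K by apply: sumr_ge0 => k _; apply: ltW; apply: (CP k).1.
have D0 : 0 < K * c + 1 by have := mulr_ge0 K0 (ltW c0); lra.
set r := e / (K * c + 1); have r0 : 0 < r by rewrite divr_gt0.
exists (r ^+ 2) => [|t tr h]; first by rewrite exprn_gt0.
have tk k : `|t k 0| <= r.
  rewrite -ler_sqr ?nnegrE ?(ltW r0)// real_normK ?num_real//.
  by apply: le_trans (ltW tr); exact: sqr_coord_le.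
have rK : r * K * c <= e.
  by rewrite /r -mulrA mulrAC ler_pdivrMr// ler_wpM2l ?ltW//; lra.
have : `|dotv h (Bcomb t *m h)| <= r * K * dotv h h.
  have -> : dotv h (Bcomb t *m h) = \sum_k t k 0 * dotv h (B k *m h).
    rewrite /dotv mulmx_suml mulmx_sumr summxE; apply: eq_bigr => k _.
    by rewrite -scalemxAl -scalemxAr mxE.
  apply: le_trans (ler_norm_sum _ _ _) _.
  rewrite -mulrA mulr_suml mulr_sumr; apply: ler_sum => k _.
  by rewrite normrM ler_pM//; apply: (CP k).2.
move/le_trans; apply; apply: le_trans (ler_wpM2r (posdef_ge0 h Pp) rK).
by rewrite -[leRHS]mulrA ler_wpM2l ?cP// mulr_ge0 ?(ltW r0).
Qed.

(** A definite [G s] is invertible, so the column space condition is automatic. *)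
Lemma Sa_minusP s : Sa_minus A B f s <-> posdef (- G A B s).
Proof.
split=> [[_ [GT Gn]]|Gp].
  split=> [|v v0]; first by rewrite linearN/= GT.
  by have := Gn v v0; rewrite bformE mulNmx dotvNr oppr_gt0.
split; last first.
  split=> [|v v0]; first exact: G_sym.
  by have := Gp.2 v v0; rewrite bformE mulNmx dotvNr oppr_gt0.
apply/in_colspaceP; exists (- (invmx (- G A B s) *m f)).
by rewrite mulmxN -mulNmx mulKVmx// posdef_unit.
Qed.

Lemma Sa_minus_open s : Sa_minus A B f s ->
  exists2 r, 0 < r & forall t, dotv t t < r -> Sa_minus A B f (s + t).
Proof.
move=> /Sa_minusP Gp; have [|r r0 rP] := @Bcomb_small _ (2^-1) Gp.
  by rewrite invr_gt0.
exists r => // t /rP Tt; apply/Sa_minusP; split=> [|v v0].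
  by rewrite linearN/= G_sym.
have := Gp.2 v v0; have := Tt v; rewrite ler_norml => /andP[_].
by rewrite GD !mulNmx (mulmxDl (G A B s)) !dotvl; lra.
Qed.

(** * Second-order analysis at a critical pair *)

Section CriticalPoint.
Variables (s : 'cV[R]_m) (x : 'cV[R]_n).
Hypotheses (Gx : G A B s *m x = f) (Lx : halfquad x = s + d).

Local Notation F := (Bcols x).

Let sE : halfquad x - d = s. Proof. by rewrite Lx addrK. Qed.

Lemma Pi_crit h : Pi A B f d (x + h) = Pi A B f d x
  + 2^-1 * dotv h (G A B s *m h)
  + 2^-1 * dotv (F^T *m h + halfquad h) (F^T *m h + halfquad h).
Proof. by rewrite PiD sE Gx subrr dotv0r addr0. Qed.

Lemma gradient_crit : gradient (Pi A B f d) x = 0.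
Proof. by rewrite gradient_Pi sE Gx subrr. Qed.

Lemma hessian_crit : hessian (Pi A B f d) x = G A B s + F *m F^T.
Proof. by rewrite hessian_Pi sE. Qed.

Lemma hessian_quad h : dotv h ((G A B s + F *m F^T) *m h) =
  dotv h (G A B s *m h) + dotv (F^T *m h) (F^T *m h).
Proof. by rewrite mulmxDl dotvDr -mulmxA dotv_trmx. Qed.

(** The only term that can have the wrong sign, F^T h . q(h) = h . T(F^T h) h / 2, is absorbed by
    the Hessian form once |F^T h| is small. *)
Lemma Pi_local_min : posdef (G A B s + F *m F^T) ->
  exists2 r, 0 < r & forall h, dotv h h < r ->
    Pi A B f d x <= Pi A B f d (x + h).
Proof.
move=> Hp; have [r r0 rP] := Bcomb_small Hp ltr01.
have [C C0 CP] := quad_bound (F *m F^T).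
exists (r / C) => [|h hr]; first by rewrite divr_gt0.
have /rP/(_ h) : dotv (F^T *m h) (F^T *m h) < r.
  rewrite dotv_trmx mulmxA; apply: le_lt_trans (ler_norm _) _.
  by apply: le_lt_trans (CP h) _; rewrite mulrC -ltr_pdivlMr.
rewrite ler_norml => /andP[+ _]; rewrite hessian_quad Pi_crit.
have := dotv_halfquad h (F^T *m h).
have := dotv_ge0 (halfquad h); rewrite !dotvl (dotvC (F^T *m h) (halfquad h)).
lra.
Qed.

(** With E the Hessian, a = F^T v and q = q(v), the change along c v is c^2 / 2 times v . E v + 2 c
    (a . q) + c^2 |q|^2. The sign of c makes the middle term nonpositive, its size keeps the last
    below - v . E v. *)
Lemma Pi_descent v : dotv v ((G A B s + F *m F^T) *m v) < 0 ->
  exists h, Pi A B f d (x + h) < Pi A B f d x.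
Proof.
rewrite hessian_quad => v0.
set a := F^T *m v in v0; set q := halfquad v.
have [|b b0 bq] := @small_sqr _ (dotv q q) (- (dotv v (G A B s *m v) + dotv a a))
  (dotv_ge0 _); first by rewrite oppr_gt0.
have [c [cb cq]] : exists c, c ^+ 2 = b ^+ 2 /\ c * dotv a q <= 0.
  have [aq|aq] := lerP (dotv a q) 0.
    by exists b; split=> //; rewrite pmulr_rle0.
  by exists (- b); split; [rewrite sqrrN | rewrite mulNr oppr_le0 mulr_ge0 ?ltW].
have c20 : 0 < c ^+ 2 by rewrite cb exprn_gt0.
exists (c *: v); rewrite Pi_crit halfquadZ -!scalemxAr -/a -/q.
rewrite !dotvl (dotvC q a) -subr_gt0; rewrite -cb in bq.
move: c20 bq cq v0; move: (dotv q q) (dotv a q) (dotv a a) (dotv v _).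
move=> Q1 Q2 Q3 Q4 c20 bq cq v0.
set e := (X in 0 < X).
have -> : e = 2^-1 * (c ^+ 2 * (- (Q4 + Q3) - c ^+ 2 * Q1 - 2 * (c * Q2))).
  by rewrite /e; field.
by rewrite mulr_gt0 ?invr_gt0// mulr_gt0//; lra.
Qed.

Hypothesis Pid_s : Pid A B f d s = Xi x s.

(* [Pid (s + t)] is the maximum of [Xi _ (s + t)], hence at least its value at
   [x + P^-1 F t], the first-order approximation of the maximizer. *)
Lemma Pid_local_min : posdef (- G A B s) ->
  (forall t, t != 0 ->
    dotv t t < dotv (F *m t) (invmx (- G A B s) *m (F *m t))) ->
  exists2 r, 0 < r & forall t, dotv t t < r ->
    Sa_minus A B f (s + t) /\ Pid A B f d s <= Pid A B f d (s + t).
Proof.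
set P := - G A B s => Pp PF; set N := F^T *m invmx P *m F.
have uP := posdef_unit Pp.
have NE t : dotv t (N *m t) = dotv (F *m t) (invmx P *m (F *m t)).
  by rewrite /N -!mulmxA dotvC dotv_trmx dotvC.
have Np : posdef (N - 1%:M).
  split=> [|t t0]; last first.
    by rewrite mulmxBl mul1mx !dotvl NE subr_gt0 PF.
  rewrite linearB/= trmx1 !trmx_mul trmxK trmx_inv mulmxA.
  by case: Pp => ->.
have [c c0 cN] := posdef_coercive Np; have [C C0 CN] := quad_bound N.
have [r1 r10 r1P] := Sa_minus_open ((Sa_minusP s).2 Pp).
(* This factor lets the cubic term be absorbed: t . N t <= C |t|^2 <= c C t . (N - 1) t. *)
have [|r2 r20 r2P] := @Bcomb_small P ((c * C)^-1) Pp.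
  by rewrite invr_gt0 mulr_gt0.
exists (Num.min r1 r2) => [|t]; first by rewrite lt_min r10.
rewrite lt_min => /andP[/r1P st /r2P tr]; split=> //.
have [Gy ->] := Pid_Xi st.1; set y := _ *m f in Gy *.
set h := invmx P *m (F *m t).
have Ph : P *m h = F *m t by rewrite mulKVmx.
have : Xi (x + h) (s + t) <= Xi y (s + t).
  rewrite -[x + h](subrK y) addrC XiDl// gerDl.
  have := posdef_ge0 (x + h - y) ((Sa_minusP _).1 st).
  by rewrite mulNmx dotvNr; lra.
apply: le_trans; rewrite XiD// Pid_s.
have Gh : G A B s *m h = - (F *m t) by rewrite -Ph mulNmx opprK.
rewrite Gh dotvNr.
have := tr h; rewrite ler_norml Ph (dotvC h) -NE => /andP[+ _].
have : (c * C)^-1 * dotv t (N *m t) <= dotv t (N *m t) - dotv t t.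
  rewrite mulrC ler_pdivrMr ?mulr_gt0//.
  have := cN t; rewrite mulmxBl mul1mx !dotvl => ct.
  have := CN t; rewrite ler_norml => /andP[_ Ct].
  apply: (le_trans Ct); rewrite mulrA [leRHS]mulrC ler_wpM2l ?(ltW C0)//.
  by rewrite mulrC.
lra.
Qed.

(** The maximizer x + h of [Xi _ (s + a *: t)] is not explicit, so the estimate must hold for every
    h. The perturbation costs at most (1 - k) h . P h; completing the square in k h - a g bounds
    twice the change by a^2 (Q / k - |t|^2) < 0. *)
Lemma Pid_descent t : posdef (- G A B s) ->
  dotv (F *m t) (invmx (- G A B s) *m (F *m t)) < dotv t t ->
  exists s', Sa_minus A B f s' /\ Pid A B f d s' < Pid A B f d s.
Proof.
set P := - G A B s => Pp; set g := invmx P *m (F *m t).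
have uP := posdef_unit Pp.
have Pg : P *m g = F *m t by rewrite mulKVmx.
rewrite -Pg dotvC; set Q := dotv g _ => QN.
have Q0 : 0 <= Q by exact: posdef_ge0.
have N0 : 0 < dotv t t by apply: le_lt_trans QN.
(* The average of Q / |t|^2 and 1, so that Q < k |t|^2 and k < 1. *)
set k := (Q + dotv t t) / (2 * dotv t t).
have kN : k * dotv t t = (Q + dotv t t) / 2.
  by rewrite /k; field; rewrite gt_eqF.
have k0 : 0 < k by rewrite divr_gt0 ?mulr_gt0//; lra.
have k1 : k < 1 by rewrite ltr_pdivrMr ?mulr_gt0//; lra.
have [r1 r10 r1P] := Sa_minus_open ((Sa_minusP s).2 Pp).
have [|r2 r20 r2P] := @Bcomb_small P (1 - k) Pp; first by rewrite subr_gt0.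
have [|a a0] := @small_sqr _ (dotv t t) (Num.min r1 r2) (ltW N0).
  by rewrite lt_min r10.
have -> : a ^+ 2 * dotv t t = dotv (a *: t) (a *: t).
  by rewrite !dotvl mulrA.
rewrite lt_min => /andP[/r1P st /r2P tr]; exists (s + a *: t); split=> //.
have [Gy ->] := Pid_Xi st.1; set y := _ *m f in Gy *.
have [h ->] : exists h, y = x + h by exists (y - x); rewrite addrC subrK.
rewrite XiD// Pid_s.
have -> : G A B s *m h = - (P *m h) by rewrite mulNmx opprK.
rewrite -scalemxAr -Pg !dotvl.
have := tr h; rewrite ler_norml => /andP[_].
have := posdef_ge0 (k *: h - a *: g) Pp.
rewrite mulmxBr -!scalemxAr !dotvl (dotv_sym g h); last by case: Pp.
rewrite -/Q; have := exprn_gt0 2 a0; move: QN kN.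
move: (dotv h (P *m h)) (dotv h (P *m g)) (dotv h (Bcomb _ *m h)) (dotv t t).
move=> X1 X2 X3 N QN kN a20 sq small.
rewrite -subr_gt0 -(pmulr_rgt0 _ k0).
have h1 := ler_wpM2l (ltW k0) small.
have h2 : a ^+ 2 * Q < a ^+ 2 * (k * N) by rewrite ltr_pM2l// kN; lra.
lra.
Qed.

End CriticalPoint.

End CanonicalDuality.

(** * The two duality statements *)

Lemma not_psd_ex {R : realType} n (M : 'M[R]_n) : M^T = M -> ~ psdmx M ->
  exists v : 'cV[R]_n, dotv v (M *m v) < 0.
Proof.
move=> MT nM; apply: contrapT => /forallNP v0; apply: nM; split=> // v.
by rewrite bformE leNgt; apply/negP/v0.
Qed.

Unset Implicit Arguments.

Theorem theorem3p1 (R : realType) (m n : nat) (hmn : m = n) (hn : (0 < n)%N)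
    (A : 'M[R]_n) (B : 'I_m -> 'M[R]_n) (f : 'cV[R]_n) (d : 'cV[R]_m)
    (hA : A^T = A) (hB : forall k, (B k)^T = B k)
    (hns : forall x : 'cV[R]_n,
       gradient (Pi A B f d) x = 0 -> \det (hessian (Pi A B f d) x) != 0)
    (sbar : 'cV[R]_m) (hcrit : critical_Pid A B f d sbar)
    (xbar : 'cV[R]_n) (hxbar : xbar = geninv (G A B sbar) *m f) :
  (Sa_plus A B f sbar ->
     (is_max_on (Pid A B f d) (Sa_plus A B f) sbar <->
      is_min_on (Pi A B f d) setT xbar))
  /\
  (Sa_minus A B f sbar ->
     exists (Xo : set 'cV[R]_n) (So : set 'cV[R]_m),
       [/\ nbhs (xbar, sbar) (Xo `*` So),
           Xo `*` So `<=` setT `*` Sa_minus A B f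
         & (is_min_on (Pi A B f d) Xo xbar <->
            is_min_on (Pid A B f d) So sbar)
           \/
           (is_max_on (Pi A B f d) Xo xbar <->
            is_max_on (Pid A B f d) So sbar)]).
Proof.
case: hcrit => Sas g0.
have := Pid_Xi d Sas; rewrite -hxbar => -[Gx PidE].
have Lx : halfquad B xbar = sbar + d by rewrite hxbar (grad_Pid_eq0 hA hB g0).
split=> [Sp|Sm].
  split=> _; [split=> // h _ | split=> // s [Sas' Gs]].
    rewrite -(subrKC xbar h) (Pi_crit hA hB Gx Lx) -addrA lerDl.
    have := Sp.2.2 (h - xbar); rewrite bformE => Gh.
    by rewrite addr_ge0 ?mulr_ge0 ?dotv_ge0 ?invr_ge0.
  have [Gy ->] := Pid_Xi d Sas'; set y := _ *m f in Gy *.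
  (* Saddle point: Xi y s <= Xi xbar s <= Xi xbar sbar. The second difference is - |s - sbar|^2 / 2,
     by [XiD] with h = 0. *)
  rewrite PidE; apply: (@le_trans _ _ (Xi A B f d xbar s)).
    rewrite -(subrKC y xbar) (XiDl _ _ _ _ Gy)// lerDl.
    by have := Gs.2 (xbar - y); rewrite bformE => ?; rewrite mulr_ge0 ?invr_ge0.
  rewrite -(addr0 xbar) -(subrKC sbar s) (XiD hA hB _ _ Gx Lx).
  rewrite !mulmx0 !dotv0l !mulr0 !addr0 gerDl oppr_le0.
  by rewrite mulr_ge0 ?invr_ge0 ?dotv_ge0.
have Pp := (Sa_minusP f hA hB sbar).1 Sm; have uP := posdef_unit Pp.
(* Identifying n with m makes F square. *)
subst n; set F := Bcols B xbar; set E := G A B sbar + F *m F^T.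
have ET : E^T = E by rewrite linearD/= trmx_mul trmxK G_sym.
have uE : E \in unitmx.
  rewrite unitmxE unitfE /E /F -(hessian_crit f hA hB Lx).
  by apply: hns; exact: (gradient_crit hA hB Gx Lx).
have [Ep|nEp] := pselect (psdmx E).
  have {}Ep := psd_unit_posdef Ep uE.
  have uF : F \in unitmx.
    (* F F^T = E - G, where E and - G are positive definite. *)
    have : F *m F^T \in unitmx.
      apply: posdef_unit; split=> [|v v0]; first by rewrite trmx_mul trmxK.
      have := Ep.2 v v0; have := Pp.2 v v0.
      by rewrite hessian_quad mulNmx dotvNr -mulmxA -(dotv_trmx F); lra.
    by rewrite unitmx_mul => /andP[].
  have PF : forall y, y != 0 ->
      dotv y (- G A B sbar *m y) < dotv (F^T *m y) (F^T *m y).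
    move=> y y0; have := Ep.2 y y0.
    by rewrite hessian_quad mulNmx dotvNr; lra.
  have [r1 r10 r1P] := Pi_local_min hA hB Gx Lx Ep.
  have [r2 r20 r2P] :=
    Pid_local_min hA hB Gx Lx PidE Pp (posdef_swap uF Pp PF).
  exists [set x | dotv (x - xbar) (x - xbar) < r1].
  exists [set s | dotv (s - sbar) (s - sbar) < r2]; split.
  - by exists ([set x | dotv (x - xbar) (x - xbar) < r1],
               [set s | dotv (s - sbar) (s - sbar) < r2]) => //; split=> /=;
      exact: nbhs_dotv_lt.
  - move=> [x s] [_ /= sr]; split=> //=.
    by rewrite -(subrKC sbar s); exact: (r2P _ sr).1.
  left; split=> _; split; rewrite /= ?subrr ?dotv0l//.
    by move=> s sr; rewrite -(subrKC sbar s); exact: (r2P _ sr).2.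
  by move=> x xr; rewrite -(subrKC xbar x); exact: r1P.
have [v vE] := not_psd_ex ET nEp.
have [h hP] := Pi_descent hA hB Gx Lx vE.
(* Otherwise, with P = - G, the bound F^T P^-1 F >= 1 makes F invertible, and [psd_swap] makes E
   positive semidefinite. *)
have [w wP] : exists w, dotv (F *m w) (invmx (- G A B sbar) *m (F *m w))
    < dotv w w.
  apply: contrapT => /forallNP H.
  have {}H w : dotv w w <= dotv (F *m w) (invmx (- G A B sbar) *m (F *m w)).
    by rewrite leNgt; apply/negP/H.
  apply: nEp; split=> // y; rewrite bformE hessian_quad.
  suff uF : F \in unitmx.
    by have := psd_swap uF uP H y; rewrite mulNmx dotvNr; lra.
  set N := F^T *m invmx (- G A B sbar) *m F.
  have : N \in unitmx.
    apply: posdef_unit; split=> [|w w0].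
      rewrite !trmx_mul trmxK trmx_inv mulmxA.
      by case: Pp => ->.
    apply: lt_le_trans (dotv_gt0 w0) (le_trans (H w) _).
    by rewrite /N -!mulmxA (dotvC w) dotv_trmx dotvC.
  by rewrite unitmx_mul => /andP[].
have [s' [s'm s'P]] := Pid_descent hA hB Gx Lx PidE Pp wP.
(* On these largest admissible sets neither point is a minimizer, so both sides of (A) are false;
   the descent points need not be near. *)
exists setT, (Sa_minus A B f); split=> //.
- exists (setT, Sa_minus A B f); last by [].
  split; first exact: filterT.
  have [r r0 rP] := Sa_minus_open hA hB Sm.
  apply: filterS (nbhs_dotv_lt sbar r0) => s sr.
  by rewrite -(subrKC sbar s); exact: rP.
left; split=> -[_ minP].
  by have := minP (xbar + h) I; rewrite leNgt hP.
by have := minP _ s'm; rewrite leNgt s'P.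
Qed.
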